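(* Let $N\in\mathbb{N}$, $p=2N+1$, let $X\in\mathbb{R}^{n\times p}$ be a fair design and let $\beta^0\in\mathbb{R}^p$ have active set $S_0=\{1,\ldots,2N\}$, so $s_0=2N$, $S_0^c=\{2N+1\}$ and $\beta^0_{2N+1}=0$. Suppose $$(X_{2k-1},X_{2k})^T(X_{2k-1},X_{2k})=\begin{pmatrix}1&-\hat\rho_k\\-\hat\rho_k&1\end{pmatrix},\quad k=1,\ldots,N,$$ where each $\hat\rho_k$ is (strictly) between $0$ and $1$, and put $\hat\varphi_k^2:=1-\hat\rho_k$. Assume that $X_{2k-1},X_{2k}$ are orthogonal to $\{X_j\}_{j\in S_0\setminus\{2k-1,2k\}}$ for all $k$. Let $$X_{2N+1}=C\sum_{j=1}^{2N}X_j/s_0+U,$$ where $C>1$, $C^2\sum_{k=1}^N2\hat\varphi_k^2/s_0^2<1$ and $U$ is orthogonal to $\{X_j\}_{j\in S_0}$. Write $\hat\tau^2:=1-C^2\sum_{k=1}^N2\hat\varphi_k^2/s_0^2$. Then $$\hat\Gamma^2(S_0)=2\|1/\hat\varphi^2\|_1+\frac{C^2}{\hat\tau^2}.$$ Moreover, for $\lambda>0$ and $\beta_{2k-1}^0\ge\beta_{2k}^0\ge\lambda/\hat\varphi_k^2+\lambda C(C-1)/(s_0\hat\tau^2)$, $k=1,\ldots,N$, the noiseless Lasso $\beta^*$ satisfies $$\|X(\beta^*-\beta^0)\|_2^2+2\lambda\|\beta_{-S_0}^*\|_1=\lambda^2\hat\Gamma^2(S_0)-\lambda^2/\hat\ta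u^2.$$
   Context: Fair design: all columns satisfy $\|X_j\|_2=1$ and there are no $j\ne k$ and constant $b$ with $X_j=bX_k$. The noiseless Lasso is $\beta^*:=\arg\min_{\beta\in\mathbb{R}^p}\{\|X(\beta-\beta^0)\|_2^2+2\lambda\|\beta\|_1\}$. Here $\|1/\hat\varphi^2\|_1:=\sum_{k=1}^N1/\hat\varphi_k^2$. For $S\subset\{1,\ldots,p\}$, $\beta_S$ is the vector with entries $\beta_j$ for $j\in S$ and $0$ otherwise, and $\beta_{-S}:=\beta_{S^c}$. The compatibility constant is $\hat\phi^2(S):=\min\{|S|\,\|X\beta\|_2^2:\ \|\beta_S\|_1=1,\ \|\beta_{-S}\|_1\le1\}$, and the effective sparsity is $\hat\Gamma^2(S):=|S|/\hat\phi^2(S)$. *)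

(* Defs.v *)
From HB Require Import structures.
From mathcomp Require Import all_boot all_order all_algebra.
From mathcomp Require Import boolp classical_sets reals.

Set Implicit Arguments.
Unset Strict Implicit.
Unset Printing Implicit Defensive.

Import Order.TTheory GRing.Theory Num.Theory.
Local Open Scope classical_set_scope.
Local Open Scope ring_scope.

Section Vectors.
Context {R : realType} {n : nat}.
Implicit Types (u v : 'cV[R]_n) (S : {set 'I_n}).

Definition dotv u v : R := \sum_i u i 0 * v i 0.

Definition l2norm u : R := Num.sqrt (\sum_i u i 0 ^+ 2).

Definition l1norm u : R := \sum_i `|u i 0|.

Definition active_set u : {set 'I_n} := [set i | u i 0 != 0]%SET.

Definition restrict S u : 'cV[R]_n := \col_i (if i \in S then u i 0 else 0).

End Vectors.

(* The value is the junk 0 when A has no least element. *)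
Definition minimum {R : realType} (A : set R) : R :=
  xget 0 [set m | A m /\ lbound A m].

Section Lasso.
Context {R : realType} {n p : nat}.
Implicit Types (X : 'M[R]_(n, p)) (b : 'cV[R]_p) (S : {set 'I_p}).

Definition fair_design X : Prop :=
  (forall j, l2norm (col j X) = 1) /\
  ~ (exists j k : 'I_p, exists c : R, j <> k /\ col j X = c *: col k X).

Definition compatibility X S : R :=
  minimum [set #|S|%:R * l2norm (X *m b) ^+ 2 | b in
    [set b | l1norm (restrict S b) = 1 /\ l1norm (restrict (~: S)%SET b) <= 1]].

(* If the minimum is not attained, or is zero, this quotient is the junk 0; so
   a nonzero value entails that the compatibility minimum is attained. *)
Definition effective_sparsity X S : R := #|S|%:R / compatibility X S.

Definition lasso_objective X (b0 : 'cV[R]_p) (lambda : R) b : R :=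
  l2norm (X *m (b - b0)) ^+ 2 + 2 * lambda * l1norm b.

(* A predicate, since an arg min need not be unique for a general X. *)
Definition is_noiseless_lasso X (b0 : 'cV[R]_p) (lambda : R) b : Prop :=
  forall b', lasso_objective X b0 lambda b <= lasso_objective X b0 lambda b'.

End Lasso.

(* Indices are 0-based: for k = 0, ..., N - 1, the k-th pair of columns
   (X_(2k-1), X_(2k) for k = 1, ..., N in 1-based notation) sits at 2k and
   2k + 1, both smaller than 2N; the last column X_(2N+1) is at ord_max. *)
Definition pair1 {N : nat} (k : 'I_N) : 'I_(2 * N).+1 := inord (2 * k).
Definition pair2 {N : nat} (k : 'I_N) : 'I_(2 * N).+1 := inord (2 * k).+1.

(* Main.v *)
Require Import Defs.
From HB Require Import structures.
From mathcomp Require Import all_boot all_order all_algebra.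
From mathcomp Require Import boolp classical_sets reals.
From mathcomp Require Import ring lra zify.

Set Implicit Arguments.
Unset Strict Implicit.
Unset Printing Implicit Defensive.

Import Order.TTheory GRing.Theory Num.Theory.
Local Open Scope ring_scope.

(** Write c = C / s0. Substituting the decomposition of the last column,
    X b = sum_k ((b_{2k-1} + c t) X_{2k-1} + (b_{2k} + c t) X_{2k}) + t U
    with t the last entry of b, so the Gram form splits into N planar forms
    plus tau^2 t^2.

    Effective sparsity: each planar form is at least
    (phi_k^2 / 2) (|b_{2k-1}| + |b_{2k}| - 2 c |t|)^2, whatever the signs; the
    arguments of these squares and C |t| add up to 1, so Cauchy-Schwarz (used in
    tangent form, with multiplier m = 1 / Gamma^2) bounds the sum below by m.
    Equality holds for b_{2k-1} = b_{2k} = m / phi_k^2 + c m C / tau^2 and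
    t = - m C / tau^2; here C > 1 gives |t| <= 1.

    Lasso: the KKT system with all signs positive is solved by
    t = lambda (C - 1) / tau^2 and b_j - b0_j = - lambda / phi_k^2 - c t for j in
    the k-th pair. For this b and any b', the objective at b' exceeds the one at b
    by at least ||X (b' - b)||^2, so a minimizer has the same image under X and, by
    pairing with U, the same last entry. *)

(** * Pair indices and the splitting of sums into pairs plus the last index *)

Lemma pair1E N (k : 'I_N) : pair1 k = (2 * k)%N :> nat.
Proof. by rewrite inordK // ltnS leq_mul2l (ltnW (ltn_ord k)). Qed.

Lemma pair2E N (k : 'I_N) : pair2 k = (2 * k).+1 :> nat.
Proof. by rewrite inordK // ltnS ltn_mul2l ltn_ord. Qed.

Lemma sum_pairs_last (V : nmodType) (N : nat) (F : 'I_(2 * N).+1 -> V) :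
  \sum_j F j = \sum_(k < N) (F (pair1 k) + F (pair2 k)) + F ord_max.
Proof.
(* [F] lives on a type fixed by [N]; extending it to all naturals through [inord] lets the induction
   vary the number of pairs. *)
pose G i := F (inord i).
have sumG m : \sum_(i < 2 * m) G i = \sum_(k < m) (G (2 * k)%N + G (2 * k).+1).
  elim: m => [|m IHm]; first by rewrite muln0 !big_ord0.
  by rewrite [in LHS]mulnS !add2n !big_ord_recr /= IHm addrA.
rewrite big_ord_recr -sumG; congr (_ + _).
apply: eq_bigr => i _; congr F; apply: val_inj.
by rewrite /= inordK // ltnS ltnW.
Qed.

(** * Bilinearity of [dotv] *)

Section DotProduct.
Context {R : realType} {n : nat}.
Implicit Types u v w : 'cV[R]_n.

Lemma dotvC u v : dotv u v = dotv v u.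
Proof. by apply: eq_bigr => i _; rewrite mulrC. Qed.

Lemma dotvDl u v w : dotv (u + v) w = dotv u w + dotv v w.
Proof. by rewrite -big_split; apply: eq_bigr => i _; rewrite !mxE mulrDl. Qed.

Lemma dotvZl c u w : dotv (c *: u) w = c * dotv u w.
Proof. by rewrite mulr_sumr; apply: eq_bigr => i _; rewrite !mxE mulrA. Qed.

Lemma dotv_suml (I : finType) (F : I -> 'cV[R]_n) w :
  dotv (\sum_i F i) w = \sum_i dotv (F i) w.
Proof.
rewrite /dotv exchange_big; apply: eq_bigr => i _.
by rewrite summxE mulr_suml.
Qed.

Lemma dotv_mulmx u v : dotv u v = (u^T *m v) 0 0.
Proof. by rewrite mxE; apply: eq_bigr => i _; rewrite mxE. Qed.

Lemma l2norm_sqr u : l2norm u ^+ 2 = dotv u u.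
Proof.
have sqE : \sum_i u i 0 ^+ 2 = dotv u u by apply: eq_bigr => i _; rewrite expr2.
rewrite /l2norm sqr_sqrtr ?sqE //.
by apply: sumr_ge0 => i _; rewrite -expr2 sqr_ge0.
Qed.

End DotProduct.

Lemma minimum_eq (R : realType) (A : set R) (m : R) :
  A m -> lbound A m -> minimum A = m.
Proof.
move=> Am lbm; apply: xget_unique; first by split.
by move=> y [Ay lby]; apply/eqP; rewrite eq_le lby ?lbm.
Qed.

(** * Gram form of mutually orthogonal pairs, and a bound for one planar form *)

Section PairedGram.
Context {R : realType} {N n : nat}.
Implicit Types (a b : 'I_N -> R) (t : R).

Definition paired_comb (x1 x2 : 'I_N -> 'cV[R]_n) (U : 'cV[R]_n) a b t :=
  \sum_k (a k *: x1 k + b k *: x2 k) + t *: U.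

Lemma dotv_paired_comb (x1 x2 : 'I_N -> 'cV[R]_n) (U : 'cV[R]_n) (rho : 'I_N -> R) :
  (forall k l, dotv (x1 k) (x1 l) = (k == l)%:R) ->
  (forall k l, dotv (x2 k) (x2 l) = (k == l)%:R) ->
  (forall k l, dotv (x1 k) (x2 l) = - rho k * (k == l)%:R) ->
  (forall k, dotv U (x1 k) = 0) -> (forall k, dotv U (x2 k) = 0) ->
  forall a b t a' b' t',
  dotv (paired_comb x1 x2 U a b t) (paired_comb x1 x2 U a' b' t') =
  \sum_k (a k * a' k + b k * b' k - rho k * (a k * b' k + b k * a' k))
    + t * t' * dotv U U.
Proof.
move=> h11 h22 h12 hU1 hU2 a b t a' b' t'.
set w := paired_comb _ _ _ a' b' t'.
have pick (c : 'I_N -> R) k : \sum_l c l * (l == k)%:R = c k.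
  by rewrite (bigD1 k) //= eqxx mulr1 big1 ?addr0 // => l /negPf ->; rewrite mulr0.
have d1 k : dotv (x1 k) w = a' k - rho k * b' k.
  rewrite dotvC dotvDl dotv_suml dotvZl hU1 mulr0 addr0.
  rewrite -(pick (fun l => a' l - rho k * b' l)); apply: eq_bigr => l _.
  by rewrite dotvDl !dotvZl h11 dotvC h12 (eq_sym k); ring.
have d2 k : dotv (x2 k) w = b' k - rho k * a' k.
  rewrite dotvC dotvDl dotv_suml dotvZl hU2 mulr0 addr0.
  (* Here [rho] carries the summed index, since [h12] attaches it to the index of [x1]; [pick] then
     evaluates it at [k]. *)
  rewrite -(pick (fun l => b' l - rho l * a' l)); apply: eq_bigr => l _.
  by rewrite dotvDl !dotvZl h22 h12; ring.
have dU : dotv U w = t' * dotv U U.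
  rewrite dotvC dotvDl dotv_suml dotvZl big1 ?add0r // => k _.
  by rewrite dotvDl !dotvZl ![dotv _ U]dotvC hU1 hU2 !mulr0 addr0.
rewrite dotvDl dotv_suml dotvZl dU mulrA; congr (_ + _).
by apply: eq_bigr => k _; rewrite dotvDl !dotvZl d1 d2; ring.
Qed.

End PairedGram.

(** Diagonalizing in the sum and difference of the coordinates gives weights [(1 - rho) / 2] and
    [(1 + rho) / 2]; lowering the second to the first discards only [rho * (a - b) ^+ 2]. *)
Lemma pair_form_ge (R : realType) (rho a b y : R) : 0 < rho < 1 ->
  (1 - rho) / 2 * (`|a| + `|b| - 2 * `|y|) ^+ 2 <=
  (a + y) ^+ 2 + (b + y) ^+ 2 - 2 * rho * ((a + y) * (b + y)).
Proof.
move=> /andP[r0 r1].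
have -> : (a + y) ^+ 2 + (b + y) ^+ 2 - 2 * rho * ((a + y) * (b + y)) =
   (1 - rho) / 2 * ((a + b + 2 * y) ^+ 2 + (a - b) ^+ 2) + rho * (a - b) ^+ 2
  by field.
suff h : (`|a| + `|b| - 2 * `|y|) ^+ 2 <= (a + b + 2 * y) ^+ 2 + (a - b) ^+ 2.
  apply: ler_wpDr; first by rewrite mulr_ge0 ?sqr_ge0 ?ltW.
  by apply: ler_wpM2l => //; lra.
(* The gap is [(|a| - |b|)^2 + 4 ((a + b) y + (|a| + |b|) |y|)], and [hy] makes its second term
   nonnegative. *)
have hy : - ((a + b) * y) <= (`|a| + `|b|) * `|y|.
  apply: le_trans (ler_norm _) _; rewrite normrN normrM.
  by rewrite ler_wpM2r // ler_normD.
have := sqr_ge0 (`|a| - `|b|).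
have := real_normK (num_real a); have := real_normK (num_real b).
have := real_normK (num_real y).
by nra.
Qed.

(** Supplies the explicit vectors used later: the compatibility minimizer, the Lasso increment and a
    test vector. *)
Lemma pairs_last_col (R : realType) (N : nat) (f g : 'I_N -> R) (t : R) :
  exists b : 'cV[R]_(2 * N).+1,
    [/\ forall k, b (pair1 k) 0 = f k, forall k, b (pair2 k) 0 = g k
      & b ord_max 0 = t].
Proof.
(* Halving gives the number of the pair and parity the position in it; the last index [2 * N] halves
   to [N], which is out of range, so [insub] yields [None]. *)
exists (\col_j if insub (j./2) is Some k then if odd j then g k else f k else t).
split=> [k|k|]; rewrite !mxE.
- rewrite pair1E mul2n doubleK odd_double insubT //= => hk.
  by congr f; apply: val_inj.
- rewrite pair2E mul2n /= uphalf_double odd_double insubT //= => hk.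
  by congr g; apply: val_inj.
- by rewrite /= mul2n doubleK insubN // ltnn.
Qed.

(** * The active set and l1 norms in terms of pairs *)

Section PairIndices.
Context {N : nat}.
Let S0 := [set j : 'I_(2 * N).+1 | (j < 2 * N)%N]%SET.

Lemma pair1_active (k : 'I_N) : pair1 k \in S0.
Proof. by rewrite inE pair1E ltn_mul2l ltn_ord. Qed.

Lemma pair2_active (k : 'I_N) : pair2 k \in S0.
Proof. by rewrite inE pair2E !mul2n ltn_Sdouble. Qed.

Lemma last_inactive : ord_max \in S0 = false.
Proof. by rewrite inE ltnn. Qed.

Lemma sum_active (V : nmodType) (F : 'I_(2 * N).+1 -> V) :
  \sum_(j in S0) F j = \sum_(k < N) (F (pair1 k) + F (pair2 k)).
Proof.
rewrite big_mkcond sum_pairs_last last_inactive addr0.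
by apply: eq_bigr => k _; rewrite pair1_active pair2_active.
Qed.

Lemma card_active : #|S0| = (2 * N)%N.
Proof.
have := sum_active (fun=> 1%N); rewrite sum1_card => ->.
by rewrite sum_nat_const card_ord mulnC.
Qed.

Context {R : realType}.
Implicit Type b : 'cV[R]_(2 * N).+1.

Lemma l1norm_pairs_last b :
  l1norm b = \sum_k (`|b (pair1 k) 0| + `|b (pair2 k) 0|) + `|b ord_max 0|.
Proof. exact: sum_pairs_last. Qed.

Lemma l1norm_active b :
  l1norm (restrict S0 b) = \sum_k (`|b (pair1 k) 0| + `|b (pair2 k) 0|).
Proof.
rewrite l1norm_pairs_last mxE last_inactive normr0 addr0.
by apply: eq_bigr => k _; rewrite !mxE pair1_active pair2_active.
Qed.

Lemma l1norm_inactive b : l1norm (restrict (~: S0)%SET b) = `|b ord_max 0|.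
Proof.
rewrite l1norm_pairs_last mxE finset.in_setC last_inactive big1 ?add0r // => k _.
by rewrite !mxE !finset.in_setC pair1_active pair2_active normr0 addr0.
Qed.

End PairIndices.

(** * Effective sparsity and noiseless Lasso, from the Gram form alone *)

Section PairedDesign.
Context {R : realType} {N n : nat}.
Let S0 := [set j : 'I_(2 * N).+1 | (j < 2 * N)%N]%SET.
Let s0 : R := (2 * N)%:R.

(** The Gram form of the design in the coordinates of [b]: the last column lies partly along the
    pairs, which shifts each pair coefficient by [C / s0] times the last entry. *)
Definition paired_form (rho : 'I_N -> R) (C tau2 : R)
    (b b' : 'cV[R]_(2 * N).+1) : R :=
  let u1 b k := b (pair1 k) 0 + C / s0 * b ord_max 0 in
  let u2 b k := b (pair2 k) 0 + C / s0 * b ord_max 0 in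
  \sum_k (u1 b k * u1 b' k + u2 b k * u2 b' k
           - rho k * (u1 b k * u2 b' k + u2 b k * u1 b' k))
  + b ord_max 0 * b' ord_max 0 * tau2.

Lemma effective_sparsity_paired (X : 'M[R]_(n, (2 * N).+1)) rho C tau2 :
  (0 < N)%N -> (forall k, 0 < rho k < 1) -> 0 < tau2 -> 1 < C ->
  (forall b b', dotv (X *m b) (X *m b') = paired_form rho C tau2 b b') ->
  effective_sparsity X S0 = 2 * (\sum_k 1 / (1 - rho k)) + C ^+ 2 / tau2.
Proof.
move=> N0 hrho tau0 C1 hform.
have s00 : 0 < s0 by rewrite ltr0n muln_gt0.
have NR0 : N%:R != 0 :> R by rewrite pnatr_eq0 -lt0n.
have phi0 k : 0 < 1 - rho k by have := hrho k; lra.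
set G := RHS.
have G0 : 0 < G.
  apply: ltr_wpDl; last by rewrite divr_gt0 // exprn_gt0 // (lt_trans ltr01).
  by rewrite mulr_ge0 // sumr_ge0 // => k _; rewrite div1r invr_ge0 ltW.
pose m := G^-1.
have m0 : 0 < m by rewrite invr_gt0.
have mG : m * G = 1 by rewrite mulVf ?gt_eqF.
(* It remains to show that the least value of the squared norm is [m]. *)
suff -> : effective_sparsity X S0 = s0 / (s0 * m).
  by rewrite invfM invrK mulrA divff ?mul1r ?gt_eqF.
rewrite /effective_sparsity card_active -/s0; congr (_ / _).
rewrite /compatibility card_active -/s0.
apply: minimum_eq; last first.
  move=> _ [b [hA _] <-]; rewrite l1norm_active in hA.
  rewrite ler_pM2l // l2norm_sqr hform /paired_form.
  set t := b ord_max 0; set c := C / s0.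
  have cs : c * s0 = C by rewrite divfK ?gt_eqF.
  pose A k := `|b (pair1 k) 0| + `|b (pair2 k) 0|.
  pose x k := A k - 2 * (c * `|t|).
  have hx : \sum_k x k + C * `|t| = 1.
    rewrite sumrB -[X in X - _]/(\sum_k (`|b (pair1 k) 0| + `|b (pair2 k) 0|)) hA.
    by rewrite sumr_const card_ord -cs /s0 natrM -mulr_natr; ring.
  (* Each square is replaced by its tangent line, at [x k = 2 * m / (1 - rho k)] and at
     [|t| = m * C / tau2]. By [hx] the lines add up to [2 * m - m ^+ 2 * G], which is [m]. *)
  apply: (@le_trans _ _ (\sum_k (2 * m * x k - 2 * m ^+ 2 * (1 / (1 - rho k)))
     + (2 * m * (C * `|t|) - m ^+ 2 * (C ^+ 2 / tau2)))).
    rewrite sumrB -2!mulr_sumr le_eqVlt; apply/orP; left; apply/eqP.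
    transitivity (2 * m * (\sum_k x k + C * `|t|) - m * (m * G)).
      by rewrite hx mG; ring.
    by rewrite /G; ring.
  apply: lerD.
    apply: ler_sum => k _.
    have h := pair_form_ge (b (pair1 k) 0) (b (pair2 k) 0) (c * t) (hrho k).
    have c0 : 0 < c by rewrite divr_gt0 // (lt_trans ltr01).
    rewrite normrM (gtr0_norm c0) -/(A k) -/(x k) in h.
    apply: le_trans (_ : (1 - rho k) / 2 * x k ^+ 2 <= _); last by lra.
    rewrite -subr_ge0.
    have -> : (1 - rho k) / 2 * x k ^+ 2 - (2 * m * x k - 2 * m ^+ 2 * (1 / (1 - rho k)))
       = (1 - rho k) / 2 * (x k - 2 * m / (1 - rho k)) ^+ 2.
      by field; rewrite gt_eqF.
    by rewrite mulr_ge0 ?sqr_ge0 // ltW // divr_gt0.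
  rewrite -subr_ge0.
  have -> : t * t * tau2 - (2 * m * (C * `|t|) - m ^+ 2 * (C ^+ 2 / tau2))
     = tau2 * (`|t| - m * C / tau2) ^+ 2.
    have -> : t * t = `|t| ^+ 2 by rewrite real_normK ?num_real // expr2.
    by field; rewrite gt_eqF.
  by rewrite mulr_ge0 ?sqr_ge0 // ltW.
have C0 : 0 < C by rewrite (lt_trans ltr01).
pose t := m * C / tau2.
have t0 : 0 < t by rewrite divr_gt0 // mulr_gt0.
(* With last entry [- t] the shift cancels the second summand, so both coefficients in pair [k]
   become [m / (1 - rho k)]. *)
pose f k := m / (1 - rho k) + C / s0 * t.
have f0 k : 0 < f k by rewrite addr_gt0 ?mulr_gt0 ?divr_gt0 // invr_gt0.
have [b [b1 b2 bt]] := pairs_last_col f f (- t).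
exists b.
  split; rewrite ?l1norm_active ?l1norm_inactive.
    under eq_bigr do rewrite b1 b2 gtr0_norm //.
    rewrite -mG big_split /= -mulr2n big_split /= sumr_const card_ord.
    under eq_bigr do rewrite -div1r mulrC.
    rewrite -mulr_suml /G /t /s0 natrM -mulr_natr.
    field; rewrite ?gt_eqF ?ltr0n //.
  (* After multiplying by [tau2 * G], the bound [t <= 1] reads [C <= G * tau2]; the right side is at
     least [C ^+ 2]. *)
  rewrite bt normrN gtr0_norm // ler_pdivrMr //.
  rewrite -mG -mulrA ler_pM2l // /G mulrDl divfK ?gt_eqF //.
  apply: ler_wpDl; last by rewrite expr2 ler_peMl ?ltW.
  rewrite mulr_ge0 ?(ltW tau0) // mulr_ge0 // sumr_ge0 // => k _.
  by rewrite div1r invr_ge0 ltW.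
congr (_ * _); rewrite l2norm_sqr hform /paired_form bt.
transitivity (\sum_k (2 * m ^+ 2 * (1 / (1 - rho k))) + t ^+ 2 * tau2).
  congr (_ + _); last by ring.
  apply: eq_bigr => k _; rewrite b1 b2 /f.
  by field; rewrite NR0 gt_eqF.
rewrite -mulr_sumr; transitivity (m * (m * G)); last by rewrite mG mulr1.
by rewrite /G /t; field; rewrite gt_eqF.
Qed.

Lemma noiseless_lasso_paired (X : 'M[R]_(n, (2 * N).+1)) rho C tau2 :
  (0 < N)%N -> (forall k, 0 < rho k < 1) -> 0 < tau2 -> 1 < C ->
  (forall b b', dotv (X *m b) (X *m b') = paired_form rho C tau2 b b') ->
  forall (b0 bstar : 'cV[R]_(2 * N).+1) (lambda : R), 0 < lambda ->
  b0 ord_max 0 = 0 ->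
  (forall k, lambda / (1 - rho k) + lambda * C * (C - 1) / (s0 * tau2)
    <= b0 (pair1 k) 0) ->
  (forall k, lambda / (1 - rho k) + lambda * C * (C - 1) / (s0 * tau2)
    <= b0 (pair2 k) 0) ->
  is_noiseless_lasso X b0 lambda bstar ->
  l2norm (X *m (bstar - b0)) ^+ 2
    + 2 * lambda * l1norm (restrict (~: S0)%SET bstar)
  = lambda ^+ 2 * (2 * (\sum_k 1 / (1 - rho k)) + (C ^+ 2 - 1) / tau2).
Proof.
move=> N0 hrho tau0 C1 hform b0 bstar lambda l0 b0t hb1 hb2 hmin.
have s00 : 0 < s0 by rewrite ltr0n muln_gt0.
have NR0 : N%:R != 0 :> R by rewrite pnatr_eq0 -lt0n.
have phi0 k : 0 < 1 - rho k by have := hrho k; lra.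
pose t := lambda * (C - 1) / tau2.
have t0 : 0 < t by rewrite divr_gt0 // mulr_gt0 // subr_gt0.
pose e k := lambda / (1 - rho k) + C / s0 * t.
have eE k : e k = lambda / (1 - rho k) + lambda * C * (C - 1) / (s0 * tau2).
  by rewrite /e /t; field; rewrite ?NR0 ?gt_eqF.
have [d [d1 d2 dt]] := pairs_last_col (fun k => - e k) (fun k => - e k) t.
(* Stationarity with all signs equal to 1, tested against an arbitrary [v]. *)
have XdE v : dotv (X *m v) (X *m d) = - lambda * \sum_j v j 0.
  rewrite hform /paired_form sum_pairs_last dt mulrDr.
  under eq_bigr => k _.
    rewrite d1 d2.
    have -> : - e k + C / s0 * t = - (lambda / (1 - rho k)) by rewrite /e; ring.
    have -> : (v (pair1 k) 0 + C / s0 * v ord_max 0) * - (lambda / (1 - rho k)) +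
      (v (pair2 k) 0 + C / s0 * v ord_max 0) * - (lambda / (1 - rho k)) -
      rho k * ((v (pair1 k) 0 + C / s0 * v ord_max 0) * - (lambda / (1 - rho k)) +
      (v (pair2 k) 0 + C / s0 * v ord_max 0) * - (lambda / (1 - rho k))) =
      - lambda * (v (pair1 k) 0 + v (pair2 k) 0)
       - lambda * 2 * (C / s0) * v ord_max 0 by field; rewrite ?NR0 ?gt_eqF.
    over.
  rewrite sumrB -mulr_sumr sumr_const card_ord -mulr_natr /t /s0 natrM.
  by field; rewrite ?NR0 ?gt_eqF //.
pose b := b0 + d.
have bE : b ord_max 0 = t by rewrite mxE b0t dt add0r.
(* The lower bounds on [b0] are what keeps the candidate nonnegative, so that its l1 norm is linear
   in its entries. *)
have b_ge0 k : 0 <= b (pair1 k) 0 /\ 0 <= b (pair2 k) 0.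
  by rewrite !mxE d1 d2 !subr_ge0 eE.
have l1b : l1norm b = \sum_j b j 0.
  rewrite l1norm_pairs_last sum_pairs_last bE gtr0_norm //; congr (_ + _).
  by apply: eq_bigr => k _; have [? ?] := b_ge0 k; rewrite !ger0_norm.
pose v := bstar - b.
(* By [XdE], the objective at [bstar] minus that at [b] is [dotv (X *m v) (X *m v)] plus
   [2 * lambda] times the excess of [l1norm bstar] over the sum of its entries, a nonnegative
   term. *)
have Xdiff : dotv (X *m v) (X *m v) <= 0.
  have := hmin b; rewrite /lasso_objective l1b.
  have -> : bstar - b0 = v + d by rewrite /v /b opprD addrA subrK.
  have -> : b - b0 = d by rewrite /b addrC addKr.
  rewrite !l2norm_sqr mulmxDr dotvDl !(dotvC _ (X *m v + X *m d)) !dotvDl.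
  rewrite (dotvC (X *m d) (X *m v)) XdE.
  have : \sum_j bstar j 0 <= l1norm bstar by apply: ler_sum => j _; exact: ler_norm.
  have -> : \sum_j v j 0 = \sum_j bstar j 0 - \sum_j b j 0.
    by rewrite -sumrB; apply: eq_bigr => j _; rewrite !mxE.
  by nra.
have Xv0 : X *m v = 0.
  have sq0 : \sum_i (X *m v) i 0 ^+ 2 = 0.
    apply: le_anti; rewrite sumr_ge0 ?andbT => [|i _]; last exact: sqr_ge0.
    by under eq_bigr do rewrite expr2.
  apply/colP => i; rewrite [RHS]mxE; apply/eqP; rewrite -sqrf_eq0; apply/eqP.
  have := sq0 => /eqP; rewrite psumr_eq0 => [/allP/(_ i)|j _]; last exact: sqr_ge0.
  by rewrite mem_index_enum => /(_ isT) /eqP.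
(* The entries [- (C / s0)] cancel the shift, so pairing [v] with [w] leaves only [tau2] times the
   last entry of [v]. *)
have [w [w1 w2 wt]] :=
  @pairs_last_col R N (fun=> - (C / s0)) (fun=> - (C / s0)) 1.
have vt : v ord_max 0 = 0.
  have := hform v w; rewrite Xv0 /paired_form wt.
  rewrite big1 => [|k _]; last by rewrite w1 w2; ring.
  rewrite [LHS]big1 => [|i _]; last by rewrite mxE mul0r.
  by move/esym/eqP; rewrite add0r mulr1 mulf_eq0 (gt_eqF tau0) orbF => /eqP.
have bstarE : bstar ord_max 0 = t by rewrite -bE; apply/eqP; rewrite -subr_eq0 -vt !mxE.
rewrite l1norm_inactive bstarE gtr0_norm //.
have -> : bstar - b0 = v + d by rewrite /v /b opprD addrA subrK.
(* Taking [v = d] in [XdE] makes the prediction error linear in the entries of [d]. *)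
rewrite mulmxDr Xv0 add0r l2norm_sqr XdE sum_pairs_last dt.
have -> : \sum_k (d (pair1 k) 0 + d (pair2 k) 0) =
    - (2 * lambda) * (\sum_k 1 / (1 - rho k)) - C * t.
  have -> : C * t = \sum_(k < N) 2 * (C / s0) * t.
    by rewrite sumr_const card_ord -[RHS]mulr_natr /s0 natrM; field.
  rewrite mulr_sumr -sumrB; apply: eq_bigr => k _.
  by rewrite d1 d2 /e; ring.
by rewrite /t; field; rewrite gt_eqF.
Qed.

End PairedDesign.

(** * From the hypotheses on the columns to the Gram form *)

Section GramOfDesign.
Context {R : realType} {N n : nat}.
Let S0 := [set j : 'I_(2 * N).+1 | (j < 2 * N)%N]%SET.
Implicit Type X : 'M[R]_(n, (2 * N).+1).

Lemma gram_pair X (k : 'I_N) r :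
  (row_mx (col (pair1 k) X) (col (pair2 k) X))^T
    *m row_mx (col (pair1 k) X) (col (pair2 k) X)
  = block_mx 1%:M (- r)%:M (- r)%:M 1%:M ->
  [/\ dotv (col (pair1 k) X) (col (pair1 k) X) = 1,
      dotv (col (pair2 k) X) (col (pair2 k) X) = 1
    & dotv (col (pair1 k) X) (col (pair2 k) X) = - r].
Proof.
rewrite tr_row_mx mul_col_row => /eq_block_mx[e11 e12 _ e22].
by rewrite !dotv_mulmx e11 e12 e22 !mxE.
Qed.

Lemma dotv_design X U (rho : 'I_N -> R) C tau2 :
  (0 < N)%N ->
  l2norm (col ord_max X) = 1 ->
  (forall k : 'I_N,
    (row_mx (col (pair1 k) X) (col (pair2 k) X))^T
      *m row_mx (col (pair1 k) X) (col (pair2 k) X)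
    = block_mx 1%:M (- rho k)%:M (- rho k)%:M 1%:M) ->
  (forall (k : 'I_N) j, j \in (S0 :\: [set pair1 k; pair2 k])%SET ->
    dotv (col (pair1 k) X) (col j X) = 0 /\
    dotv (col (pair2 k) X) (col j X) = 0) ->
  (forall j, j \in S0 -> dotv U (col j X) = 0) ->
  col ord_max X = C *: (\sum_(j in S0) (#|S0|%:R)^-1 *: col j X) + U ->
  tau2 = 1 - C ^+ 2 * (\sum_(k < N) 2 * (1 - rho k) / #|S0|%:R ^+ 2) ->
  forall b b', dotv (X *m b) (X *m b') = paired_form rho C tau2 b b'.
Proof.
move=> N0 hnorm hgram horth hU hlast htau2 b b'.
pose x1 k := col (pair1 k) X; pose x2 k := col (pair2 k) X.
pose c : R := C / (2 * N)%:R.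
have NR0 : N%:R != 0 :> R by rewrite pnatr_eq0 -lt0n.
have off (k l : 'I_N) : k != l ->
    pair1 l \in (S0 :\: [set pair1 k; pair2 k])%SET /\
    pair2 l \in (S0 :\: [set pair1 k; pair2 k])%SET.
  move=> kl; rewrite !finset.in_setD pair1_active pair2_active !inE !andbT.
  have := kl; rewrite -!(inj_eq val_inj) /= !pair1E !pair2E; lia.
have h11 k l : dotv (x1 k) (x1 l) = (k == l)%:R.
  have [<-|/off[/horth[-> _] _] //] := eqVneq k l.
  by have [-> _ _] := gram_pair (hgram k).
have h22 k l : dotv (x2 k) (x2 l) = (k == l)%:R.
  have [<-|/off[_ /horth[_ ->]] //] := eqVneq k l.
  by have [_ -> _] := gram_pair (hgram k).
have h12 k l : dotv (x1 k) (x2 l) = - rho k * (k == l)%:R.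
  have [<-|/off[_ /horth[-> _]]] := eqVneq k l; last by rewrite mulr0.
  by have [_ _ ->] := gram_pair (hgram k); rewrite mulr1.
have hU1 k : dotv U (x1 k) = 0 by apply/hU/pair1_active.
have hU2 k : dotv U (x2 k) = 0 by apply/hU/pair2_active.
have lastE : col ord_max X = paired_comb x1 x2 U (fun=> c) (fun=> c) 1.
  rewrite hlast scaler_sumr sum_active card_active /paired_comb scale1r.
  by congr (_ + _); apply: eq_bigr => k _; rewrite !scalerA.
have dotE := dotv_paired_comb h11 h22 h12 hU1 hU2.
(* The last column has unit length; its part along the pairs has squared length [c ^+ 2] times the
   sum of [2 * (1 - rho k)], and [U] accounts for the rest. *)
have UU : dotv U U = tau2.
  have := congr1 (fun x => x ^+ 2) hnorm.
  rewrite /= l2norm_sqr lastE dotE expr1n mulr1 mul1r => /esym/eqP.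
  rewrite addrC -subr_eq => /eqP <-; rewrite htau2 card_active mulr_sumr.
  by congr (_ - _); apply: eq_bigr => k _; rewrite /c natrM; field.
have combE d : X *m d = paired_comb x1 x2 U
    (fun k => d (pair1 k) 0 + c * d ord_max 0)
    (fun k => d (pair2 k) 0 + c * d ord_max 0) (d ord_max 0).
  have -> : X *m d = \sum_j d j 0 *: col j X.
    apply/colP => i; rewrite mxE summxE; apply: eq_bigr => j _.
    by rewrite !mxE mulrC.
  rewrite sum_pairs_last lastE /paired_comb scalerDr addrA scale1r.
  congr (_ + _); rewrite scaler_sumr -big_split; apply: eq_bigr => k _ /=.
  by rewrite scalerDr !scalerA !scalerDl [_ * c]mulrC addrACA.
by rewrite !combE dotE UU.
Qed.

End GramOfDesign.

Theorem lemma10p1 (R : realType) (N n : nat) (hN : (0 < N)%N)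
  (X : 'M[R]_(n, (2 * N).+1)) (hX : fair_design X)
  (b0 : 'cV[R]_((2 * N).+1))
  (S0 : {set 'I_(2 * N).+1})
  (hS0 : S0 = [set j : 'I_(2 * N).+1 | (j < 2 * N)%N]%SET)
  (hb0 : active_set b0 = S0)
  (rho : 'I_N -> R) (hrho : forall k, 0 < rho k < 1)
  (hgram : forall k : 'I_N,
    (row_mx (col (pair1 k) X) (col (pair2 k) X))^T
      *m row_mx (col (pair1 k) X) (col (pair2 k) X)
    = block_mx 1%:M (- rho k)%:M (- rho k)%:M 1%:M)
  (phi2 : 'I_N -> R) (hphi2 : forall k, phi2 k = 1 - rho k)
  (horth : forall (k : 'I_N) (j : 'I_(2 * N).+1),
    j \in (S0 :\: [set pair1 k; pair2 k])%SET ->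
    dotv (col (pair1 k) X) (col j X) = 0 /\
    dotv (col (pair2 k) X) (col j X) = 0)
  (C : R) (hC : 1 < C)
  (hC2 : C ^+ 2 * (\sum_(k < N) 2 * phi2 k / #|S0|%:R ^+ 2) < 1)
  (U : 'cV[R]_n) (hU : forall j, j \in S0 -> dotv U (col j X) = 0)
  (hlast : col ord_max X =
    C *: (\sum_(j in S0) (#|S0|%:R)^-1 *: col j X) + U)
  (tau2 : R)
  (htau2 : tau2 = 1 - C ^+ 2 * (\sum_(k < N) 2 * phi2 k / #|S0|%:R ^+ 2)) :
  effective_sparsity X S0 = 2 * (\sum_(k < N) 1 / phi2 k) + C ^+ 2 / tau2
  /\
  (forall lambda : R, 0 < lambda ->
   (forall k : 'I_N,
     b0 (pair1 k) 0 >= b0 (pair2 k) 0 /\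
     b0 (pair2 k) 0 >=
       lambda / phi2 k + lambda * C * (C - 1) / (#|S0|%:R * tau2)) ->
   forall bstar : 'cV[R]_((2 * N).+1),
   is_noiseless_lasso X b0 lambda bstar ->
   l2norm (X *m (bstar - b0)) ^+ 2
     + 2 * lambda * l1norm (restrict (~: S0)%SET bstar)
   = lambda ^+ 2 * effective_sparsity X S0 - lambda ^+ 2 / tau2).
Proof.
subst S0 tau2.
have phiE : phi2 = fun k => 1 - rho k by apply/funext.
subst phi2.
have hform := dotv_design hN (hX.1 ord_max) hgram horth hU hlast erefl.
rewrite (effective_sparsity_paired hN hrho _ hC hform) ?subr_gt0 //.
split=> // lambda l0 hbeta bstar hmin.
have b0last : b0 ord_max 0 = 0.
  by apply/eqP; have := last_inactive (N := N); rewrite -hb0 inE => /negbFE.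
rewrite card_active in hbeta hC2 hform *.
rewrite (noiseless_lasso_paired hN hrho _ hC hform l0 b0last _ _ hmin) ?subr_gt0 //.
(* The Lasso value has [C ^+ 2 - 1] where the effective sparsity has [C ^+ 2], hence the subtracted
   [lambda ^+ 2 / tau2]. *)
- by ring.
- by move=> k; have [h1 h2] := hbeta k; apply: le_trans h1.
- by move=> k; have [_ h2] := hbeta k.
Qed.
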